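(* Let $a,b,c\in\mathbb{R}$ be such that $a>-1$, $b>-1$ and $c>\max\{0,a-b\}$ and let $\{P_n^{[d]}(x):=P_n^{[d]}(x;a,b,c)\}_{n\in\mathbb{N}}$, $d\in\{0,1\}$, be the monic $2$-orthogonal polynomial sequence with respect to $\overline{\mathcal{W}}^{[d]}(x;a,b,c)$. Then $$P_n^{[d]}(x)=\frac{(-1)^n(a+1)_n(b+1)_n}{\left(c+b+1+\left\lfloor\frac{n+d}{2}\right\rfloor\right)_n}\;{}_2F_2\left(\begin{matrix}-n,\ c+b+1+\left\lfloor\frac{n+d}{2}\right\rfloor\\ a+1,\ b+1\end{matrix};\,x\right)$$ or, equivalently, $$P_n^{[d]}(x)=\sum_{j=0}^n\tau_{n,j}^{[d]}\,x^j\quad\text{with}\quad \tau_{n,j}^{[d]}=(-1)^{n-j}\binom{n}{j}\frac{(a+1+j)_{n-j}\,(b+1+j)_{n-j}}{\left(c+b+1+\left\lfloor\frac{n+d}{2}\right\rfloor+j\right)_{n-j}}.$$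
   Context: $\mathbb{N}=\{0,1,2,\dots\}$; $(z)_0=1$, $(z)_k=z(z+1)\cdots(z+k-1)$ is the Pochhammer symbol; ${}_2F_2\left(\begin{matrix}\alpha_1,\alpha_2\\ \beta_1,\beta_2\end{matrix};z\right)=\sum_{m\ge0}\frac{(\alpha_1)_m(\alpha_2)_m}{(\beta_1)_m(\beta_2)_m}\frac{z^m}{m!}$. For $\alpha>0$, $\beta\in\mathbb{R}$, $x>0$, the Tricomi function is $\mathbf{U}(\alpha,\beta;x)=\frac{1}{\Gamma(\alpha)}\int_0^\infty t^{\alpha-1}(t+1)^{\beta-\alpha-1}e^{-tx}\,dt$. For $a>-1$, $b>-1$, $c>\max\{0,a-b\}$ and $x>0$ define $$\mathcal{W}(x;a,b,c)=\frac{\Gamma(c+b+1)}{\Gamma(a+1)\Gamma(b+1)}\,e^{-x}x^a\,\mathbf{U}(c,a-b+1;x),\qquad \overline{\mathcal{W}}^{[d]}(x;a,b,c)=\begin{bmatrix}\mathcal{W}(x;a,b,c+d)\\ \mathcal{W}(x;a,b,c+1-d)\end{bmatrix},\quad d\in\{0,1\}.$$ A polynomial sequence $\{P_n\}_{n\in\mathbb{N}}$ ($\deg P_n=n$) is $2$-orthogonal with respect to a vector of weights $(w_0,w_1)$ on $(0,\infty)$ if for all $k,n\in\mathbb{N}$: $\int_0^\infty x^kP_n w_0\,dx=0$ if $n\ge 2k+1$ and $\neq0$ if $n=2k$; and $\int_0^\infty x^kP_n w_1\,dx=0$ if $n\ge 2k+2$ and $\neq 0$ if $n=2k+1$. *)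

(* Defs.v *)
From HB Require Import structures.
From mathcomp Require Import all_boot all_order all_algebra.
From mathcomp Require Import all_classical all_reals all_analysis.

Set Implicit Arguments.
Unset Strict Implicit.
Unset Printing Implicit Defensive.

Import Order.TTheory GRing.Theory Num.Theory.
Import numFieldNormedType.Exports.

Local Open Scope classical_set_scope.
Local Open Scope ring_scope.

Definition pochhammer (R : realType) (z : R) (k : nat) : R :=
  \prod_(i < k) (z + i%:R).

Definition hyp2F2 (R : realType) (al1 al2 be1 be2 z : R) : R :=
  limn (series (fun m : nat =>
    pochhammer al1 m * pochhammer al2 m / (pochhammer be1 m * pochhammer be2 m)
      * (z ^+ m / (m`!)%:R))).

(* Real-valued Lebesgue integral over (0, +oo); like [Rintegral], it has a
   conventional value when the integrand is not integrable. *)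
Definition integral_pos (R : realType) (f : R -> R) : R :=
  \int[@lebesgue_measure R]_(x in `]0, +oo[) f x.

(* Euler's integral: meaningful for z > 0 only. *)
Definition Gamma (R : realType) (z : R) : R :=
  integral_pos (fun t => t `^ (z - 1) * expR (- t)).

(* Meaningful for al > 0 and x > 0 only. *)
Definition tricomiU (R : realType) (al be x : R) : R :=
  (Gamma al)^-1 *
  integral_pos (fun t =>
    t `^ (al - 1) * (t + 1) `^ (be - al - 1) * expR (- (t * x))).

Definition weightW (R : realType) (a b c x : R) : R :=
  Gamma (c + b + 1) / (Gamma (a + 1) * Gamma (b + 1))
    * expR (- x) * x `^ a * tricomiU c (a - b + 1) x.

(* The vector of weights is encoded as the pair of its entries. *)
Definition weightWbar (R : realType) (d : nat) (a b c : R) :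
    (R -> R) * (R -> R) :=
  (weightW a b (c + d%:R), weightW a b (c + 1 - d%:R)).

(* No integrability clause is imposed: all the moments of [weightW] are finite
   in the parameter range a > -1, b > -1, c > max(0, a - b). *)
Definition two_orthogonal (R : realType) (P : nat -> {poly R})
    (w : (R -> R) * (R -> R)) : Prop :=
  (forall n : nat, size (P n) = n.+1) /\
  (forall k n : nat,
    [/\ (2 * k + 1 <= n)%N ->
          integral_pos (fun x => x ^+ k * (P n).[x] * w.1 x) = 0,
        n = (2 * k)%N ->
          integral_pos (fun x => x ^+ k * (P n).[x] * w.1 x) <> 0,
        (2 * k + 2 <= n)%N ->
          integral_pos (fun x => x ^+ k * (P n).[x] * w.2 x) = 0
      & n = (2 * k + 1)%N ->
          integral_pos (fun x => x ^+ k * (P n).[x] * w.2 x) <> 0]).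

Definition tau (R : realType) (d : nat) (a b c : R) (n j : nat) : R :=
  (-1) ^+ (n - j) * ('C(n, j))%:R *
  (pochhammer (a + 1 + j%:R) (n - j) * pochhammer (b + 1 + j%:R) (n - j)
    / pochhammer (c + b + 1 + ((n + d)./2)%:R + j%:R) (n - j)).

(* Main.v *)
Require Import Defs.
From HB Require Import structures.
From mathcomp Require Import all_boot all_order all_algebra.
From mathcomp Require Import all_classical all_reals all_analysis.
From mathcomp Require Import measurable_realfun.
From mathcomp Require Import zify ring lra.

Set Implicit Arguments.
Unset Strict Implicit.
Unset Printing Implicit Defensive.

Import Order.TTheory GRing.Theory Num.Theory.
Import numFieldNormedType.Exports.

Local Open Scope ring_scope.

(** The weight is explicit only through its moments, and these are all that
    the orthogonality conditions see.  Inserting the integral that defines the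
    Tricomi function and exchanging the two integrations gives
    [[ int x^k W(x;a,b,c) dx = (a+1)_k (b+1)_k / (c+b+1)_k ]]
    ([integral_weightW_moment]): the x-integral is a Gamma integral, the
    remaining t-integral is a Beta integral of the second kind.  The value
    of that Beta integral, and with it the functional equation and the
    finiteness of Gamma, come from the same exchange of integrations
    ([integral_laplace_powR], [egammaM]).

    The rest is algebra.  Write e = c+b+1 and M = floor((n+d)/2).  The weight
    with parameter c+d' (where {d', 1-d'} = {d, 1-d}) and the power x^k pair
    with the proposed polynomial to a constant multiple of
    [[ sum_j (-1)^(n-j) C(n,j) (a+1+j)_k (b+1+j)_k (e+M)_j / (e+d')_(k+j). ]]
    The choice of M makes the last quotient a polynomial in j: it is
    proportional to (e+d'+k+j)_(M-d'-k).  So the sum is the n-th finite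
    difference of a polynomial of degree M+k-d', which is smaller than n for
    all the powers occurring in the orthogonality conditions, and the sum
    vanishes ([sum_tau_moment_eq0]).

    Finally, monic polynomials satisfying these conditions are unique.  The
    two weights are interleaved into a single sequence of functionals l_j,
    namely q |-> int x^floor(j/2) q w, with w the first weight for even j and
    the second one for odd j; against it the given P_i form a triangular array
    with nonzero diagonal, so a polynomial of degree less than n that is
    annihilated by l_0, ..., l_(n-1) is zero ([biorthogonal_eq0]).  This
    applies to the difference of P_n and the proposed polynomial. *)

(** * Exchanging integrations *)

Section tonelli_on.
Local Open Scope ereal_scope.
Context d1 d2 (T1 : measurableType d1) (T2 : measurableType d2) (R : realType).
Variables (m1 : {sigma_finite_measure set T1 -> \bar R})
  (m2 : {sigma_finite_measure set T2 -> \bar R}).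

(** The two domains are absorbed into the integrand as indicator functions. *)
Lemma tonelli_on (A : set T1) (B : set T2) (f : T1 * T2 -> R) :
  measurable A -> measurable B ->
  measurable_fun setT f -> (forall z, 0 <= f z)%R ->
  \int[m1]_(x in A) \int[m2]_(y in B) (f (x, y))%:E =
  \int[m2]_(y in B) \int[m1]_(x in A) (f (x, y))%:E.
Proof.
move=> mA mB mf f0.
pose g (z : T1 * T2) : \bar R := (f z * (\1_A z.1 * \1_B z.2))%:E.
have mg : measurable_fun setT g.
  apply/measurable_EFinP; apply: measurable_funM => //.
  by apply: measurable_funM; apply: measurableT_comp.
have g0 z : 0 <= g z by rewrite lee_fin !mulr_ge0.
have setE d (T : measurableType d) (m : {measure set T -> \bar R})
    (C : set T) (h : T -> R) (c : R) :
    measurable C -> measurable_fun setT h -> (forall x, 0 <= h x)%R ->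
    (0 <= c)%R ->
    (\int[m]_(x in C) (h x)%:E) * c%:E = \int[m]_x (h x * (c * \1_C x))%:E.
  move=> mC mh h0 c0; rewrite integral_mkcond.
  rewrite (eq_integral (fun x => (h x * \1_C x)%:E)); last first.
    move=> x _; rewrite patchE indicE.
    by case: ifPn => _; rewrite ?mulr1 ?mulr0.
  rewrite -ge0_integralZr//.
  - by apply: eq_integral => x _; rewrite -EFinM mulrAC -mulrA.
  - by apply/measurable_EFinP/measurable_funM.
  - by move=> x _; rewrite lee_fin mulr_ge0.
have indE d (T : measurableType d) (m : {measure set T -> \bar R})
    (C : set T) (h : T -> \bar R) :
    \int[m]_(x in C) h x = \int[m]_x (h x * (\1_C x)%:E).
  rewrite integral_mkcond; apply: eq_integral => x _.
  by rewrite patchE indicE; case: ifPn => _; rewrite ?mule1 ?mule0.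
rewrite indE [RHS]indE.
transitivity (\int[m1]_x \int[m2]_y g (x, y)).
  apply: eq_integral => x _.
  by rewrite (setE _ _ m2 B _ _ mB (measurable_fun_pair2 x mf)).
rewrite (fubini_tonelli g mg g0).
apply: eq_integral => y _.
rewrite (setE _ _ m1 A _ _ mA (measurable_fun_pair1 y mf))//.
by apply: eq_integral => x _; rewrite /g/= (mulrC (\1_B y)).
Qed.

End tonelli_on.

(** * Scaling on the half-line *)

Section half_line.
Context {R : realType}.
Local Open Scope classical_set_scope.
Local Open Scope ring_scope.
Local Notation mu := (@lebesgue_measure R).
Local Notation D := (`]0, +oo[%classic : set R).
Implicit Types (s u p q c be x t : R).

Lemma measurable_EFin_on (A : set R) (f : R -> R) : measurable_fun setT f ->
  measurable_fun A (fun x => (f x)%:E).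
Proof. by move=> mf; apply/measurable_EFinP; exact: measurable_funTS. Qed.

Lemma integral_half_lineZe (c : \bar R) (f : R -> R) : (0 <= c)%E ->
  measurable_fun setT f -> (forall x, 0 <= f x) ->
  (\int[mu]_(x in D) (c * (f x)%:E) = c * \int[mu]_(x in D) (f x)%:E)%E.
Proof.
move=> c0 mf f0; rewrite -ge0_integralZl.
- by [].
- exact: measurable_itv.
- exact: measurable_EFin_on.
- by move=> x _; rewrite lee_fin.
- by [].
Qed.

Lemma integral_half_lineZl c (f : R -> R) : 0 <= c ->
  measurable_fun setT f -> (forall x, 0 <= f x) ->
  (\int[mu]_(x in D) (c * f x)%R%:E = c%:E * \int[mu]_(x in D) (f x)%:E)%E.
Proof.
by move=> c0 mf f0; rewrite -(integral_half_lineZe _ mf f0)// lee_fin.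
Qed.

Lemma cvg_integral_half_line (f : R -> R) (e : R) : 0 < e ->
  measurable_fun setT f -> (forall x, 0 <= f x) ->
  (\int[mu]_(x in `[(e * (n.+1%:R)^-1)%R, +oo[) (f x)%:E @[n --> \oo]
   --> \int[mu]_(x in D) (f x)%:E)%E.
Proof.
move=> e0 mf f0.
have -> : D = \bigcup_n `[e * (n.+1%:R)^-1, +oo[%classic.
  apply/seteqP; split=> [x /=|x [n _] /=]; rewrite !in_itv/= !andbT; last first.
    by apply: lt_le_trans; rewrite mulr_gt0// invr_gt0 ltr0n.
  move=> x0; exists (Num.truncn (e / x)) => //=.
  rewrite in_itv/= andbT ler_pdivrMr ?ltr0n// mulrC -ler_pdivrMr//.
  by rewrite ltW// truncnS_gt.
apply: (@ge0_nondecreasing_set_cvg_integral _ (measurableTypeR R) R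
  (fun n => `[e * (n.+1%:R)^-1, +oo[%classic) (fun x => (f x)%:E) mu) => //.
- apply/nondecreasing_seqP => n; rewrite subsetEset => x /=.
  rewrite !in_itv/= !andbT; apply: le_trans.
  by rewrite ler_pM2l// lef_pV2 ?posrE ?ltr0n// ler_nat.
- by move=> n; exact: measurable_EFin_on.
- by move=> n x _; rewrite /= lee_fin.
Qed.

(** The substitution rule for half-lines asks for an integrand continuous up to
    the endpoint, which fails for [x `^ (s - 1)] at [0] when [s < 1]; hence the
    exhaustion by the closed half-lines from [1 / n.+1] on, which the
    substitution carries to those from [u / n.+1] on. *)
Lemma integral_half_line_scale (f : R -> R) (u : R) : 0 < u ->
  measurable_fun setT f -> (forall x, 0 <= f x) ->
  {in `]0, +oo[, continuous f} ->
  (\int[mu]_(x in D) (f x)%:E = \int[mu]_(x in D) (u * f (u * x))%R%:E)%E.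
Proof.
move=> u0 mf f0 cf.
have mg : measurable_fun setT (fun x => u * f (u * x)).
  by apply: measurable_funM => //; apply: measurableT_comp => //;
    apply: measurable_funM.
have g0 x : 0 <= u * f (u * x) by rewrite mulr_ge0// ltW.
have l := cvg_integral_half_line u0 mf f0.
have l' := cvg_integral_half_line ltr01 mg g0.
apply: (cvg_unique _ l) => //; apply: cvg_trans l'.
apply: near_eq_cvg; apply: nearW => n; rewrite mul1r.
pose F (x : R) := u * x.
have dF : F^`()%classic = fun=> u.
  by apply/funext => x; rewrite /F derive1Ml// derive1_id mulr1.
have e0 : 0 < (n.+1%:R : R)^-1 by rewrite invr_gt0 ltr0n.
rewrite (@increasing_ge0_integration_by_substitutiony _ F f (n.+1%:R)^-1).
- by apply: eq_integral => x _; rewrite /= fctE dF /= mulrC.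
- by move=> x y _ _ xy; rewrite /F ltr_pM2l.
- by move=> x _; rewrite dF; exact: cvg_cst.
- by rewrite dF; exact: is_cvg_cst.
- by rewrite dF; exact: is_cvg_cst.
- split; first by move=> x _; rewrite /F; apply: derivableM => //.
  by apply: cvg_at_right_filter; rewrite /F; apply: cvgMl_tmp; exact: cvg_id.
- by rewrite /F; exact: gt0_cvgMry.
- apply/continuous_within_itvcyP.
  have uen : 0 < F n.+1%:R^-1 by rewrite /F mulr_gt0.
  split.
    move=> x; rewrite in_itv/= andbT => xu; apply: cf.
    by rewrite in_itv/= andbT (lt_trans _ xu).
  by apply: cvg_at_right_filter; apply: cf; rewrite in_itv/= uen.
- by move=> x _.
Qed.

(** * Gamma and Beta integrals *)

Lemma measurable_powR_shift p q :
  measurable_fun setT (fun t => t `^ p * (t + 1) `^ q).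
Proof.
apply: measurable_funM; first exact: measurable_powR.
apply: (measurableT_comp (f := fun y => y `^ q)); first exact: measurable_powR.
exact: measurable_funD.
Qed.

Lemma measurable_expRM x : measurable_fun setT (fun t => expR (- (t * x))).
Proof.
apply: measurableT_comp => //; apply: measurableT_comp => //.
exact: measurable_funM.
Qed.

(** Extended-real valued, so that the identities below hold, and can be used to
    prove finiteness, before finiteness is known. *)
Definition egamma s : \bar R :=
  (\int[mu]_(x in D) (x `^ (s - 1) * expR (- x))%R%:E)%E.

Lemma measurable_gamma_integrand s u :
  measurable_fun setT (fun x => x `^ (s - 1) * expR (- (u * x))).
Proof.
apply: measurable_funM; first exact: measurable_powR.
under eq_fun do rewrite mulrC.
exact: measurable_expRM.
Qed.

Lemma measurable_gamma_density s :
  measurable_fun setT (fun x => x `^ (s - 1) * expR (- x)).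
Proof.
have := measurable_gamma_integrand s 1.
by under eq_fun do rewrite mul1r.
Qed.

Lemma gamma_density_ge0 s x : 0 <= x `^ (s - 1) * expR (- x).
Proof. by rewrite mulr_ge0 ?powR_ge0 ?expR_ge0. Qed.

Lemma egamma_ge0 s : (0 <= egamma s)%E.
Proof. by apply: integral_ge0 => x _; rewrite lee_fin gamma_density_ge0. Qed.

Lemma laplace_powR s u : 0 < u ->
  (\int[mu]_(x in D) (x `^ (s - 1) * expR (- (u * x)))%R%:E =
   (u `^ (- s))%:E * egamma s)%E.
Proof.
move=> u0.
have mg := measurable_gamma_integrand s.
have us0 : 0 <= u `^ s by exact: powR_ge0.
have uD : u `^ s = u * u `^ (s - 1).
  rewrite -{2}(powRr1 (ltW u0)) -powRD ?(gt_eqF u0) ?implybT//.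
  by congr (_ `^ _); ring.
have f0 v x : 0 <= x `^ (s - 1) * expR (- (v * x)).
  by rewrite mulr_ge0 ?powR_ge0 ?expR_ge0.
have -> : egamma s = ((u `^ s)%:E *
    \int[mu]_(x in D) (x `^ (s - 1) * expR (- (u * x)))%R%:E)%E.
  rewrite -(integral_half_lineZl us0 (mg u) (f0 u)) /egamma.
  transitivity (\int[mu]_(x in D) (x `^ (s - 1) * expR (- (1 * x)))%R%:E)%E.
    by apply: eq_integral => x _; rewrite mul1r.
  rewrite (integral_half_line_scale u0 (mg 1) (f0 1)).
    apply: eq_integral => x; rewrite inE/= in_itv/= andbT => x0; congr EFin.
    by rewrite mul1r uD powRM ?ltW//; ring.
  move=> x; rewrite in_itv/= andbT => x0.
  apply: cvgM.
    have : derivable (fun y => y `^ (s - 1)) x 1.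
      by apply: derivable_powR; rewrite in_itv/= x0.
    by move/derivable1_diffP/differentiable_continuous.
  apply: continuous_comp; last exact: continuous_expR.
  by apply: cvgN; apply: cvgMl_tmp; exact: cvg_id.
rewrite muleA -EFinM -powRD ?(gt_eqF u0) ?implybT//.
by rewrite addNr powRr0 mul1e.
Qed.

(** The exchange of integrations behind both the moments of the weight and the
    Beta integral: integrating in [x] first, [laplace_powR] at [u = t + 1]
    contributes the factor [(t + 1) `^ (- s)]. *)
Lemma integral_laplace_powR s c be :
  (\int[mu]_(x in D) ((x `^ (s - 1) * expR (- x))%R%:E *
     \int[mu]_(t in D) (t `^ (c - 1) * (t + 1) `^ be * expR (- (t * x)))%R%:E) =
   egamma s * \int[mu]_(t in D) (t `^ (c - 1) * (t + 1) `^ (be - s))%R%:E)%E.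
Proof.
pose f (z : R * R) := z.1 `^ (s - 1) * expR (- z.1) *
  (z.2 `^ (c - 1) * (z.2 + 1) `^ be * expR (- (z.2 * z.1))).
have mx := measurable_gamma_density s.
have mt := measurable_powR_shift (c - 1) be.
have mtx x : measurable_fun setT
    (fun t => t `^ (c - 1) * (t + 1) `^ be * expR (- (t * x))).
  by apply: measurable_funM => //; exact: measurable_expRM.
have mf : measurable_fun setT f.
  apply: measurable_funM; first exact: (measurableT_comp mx).
  apply: measurable_funM; first exact: (measurableT_comp mt).
  apply: measurableT_comp => //; apply: measurableT_comp => //.
  exact: measurable_funM.
have f0 z : 0 <= f z by rewrite !mulr_ge0 ?powR_ge0 ?expR_ge0.
transitivity (\int[mu]_(x in D) \int[mu]_(t in D) (f (x, t))%:E)%E.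
  apply: eq_integral => x _; rewrite /f/= (integral_half_lineZl _ (mtx x))//.
  - by rewrite !mulr_ge0 ?powR_ge0 ?expR_ge0.
  - by move=> t; rewrite !mulr_ge0 ?powR_ge0 ?expR_ge0.
have -> := @tonelli_on _ _ (measurableTypeR R) (measurableTypeR R) R mu mu
  D D f (measurable_itv _) (measurable_itv _) mf f0.
rewrite -(integral_half_lineZe (egamma_ge0 s) (measurable_powR_shift _ _));
  last by move=> t; rewrite mulr_ge0 ?powR_ge0.
apply: eq_integral => t; rewrite inE/= in_itv/= andbT => t0.
have t10 : 0 < t + 1 by rewrite addr_gt0.
rewrite (@powRD _ (t + 1)) ?(gt_eqF t10) ?implybT// mulrA EFinM muleC -muleA.
rewrite -laplace_powR//.
rewrite -(integral_half_lineZl _ (measurable_gamma_integrand s _)).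
- apply: eq_integral => x _; rewrite /f/=; congr EFin.
  by rewrite mulrDl mul1r opprD expRD; ring.
- by rewrite !mulr_ge0 ?powR_ge0.
- by move=> x; rewrite !mulr_ge0 ?powR_ge0 ?expR_ge0.
Qed.

(** The product formula for the Beta integral of the second kind: the case
    [s = p + q], [be = 0] of [integral_laplace_powR], whose inner integral is
    then itself a Gamma integral. *)
Lemma egammaM p q :
  (egamma p * egamma q = egamma (p + q) *
    \int[mu]_(t in D) (t `^ (p - 1) * (t + 1) `^ (- (p + q)))%R%:E)%E.
Proof.
have := integral_laplace_powR (p + q) p 0; rewrite sub0r => <-.
rewrite {2}/egamma -(integral_half_lineZe (egamma_ge0 p)
  (measurable_gamma_density q) (gamma_density_ge0 q)).
apply: eq_integral => x; rewrite inE/= in_itv/= andbT => x0.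
under [in RHS]eq_integral do rewrite powRr0 mulr1 [_ * x]mulrC.
rewrite laplace_powR// muleA -EFinM muleC; congr (_%:E * _)%E.
rewrite mulrAC -powRD ?(gt_eqF x0) ?implybT//.
by congr (_ `^ _ * _); ring.
Qed.

Lemma cvg_powR_shift s : 0 < s -> (t + 1) `^ (- s) @[t --> +oo] --> (0 : R).
Proof.
move=> s0; apply/cvgrPdist_le => e e0; near=> t.
have t0 : 0 < t + 1.
  rewrite addr_gt0//; near: t; exact: nbhs_pinfty_gt.
have et : e^-1 `^ s^-1 <= t + 1.
  rewrite -lerBlDr; near: t; exact: nbhs_pinfty_ge.
rewrite sub0r normrN ger0_norm ?powR_ge0// powRN -[leRHS]invrK.
rewrite lef_pV2 ?posrE ?powR_gt0 ?invr_gt0//.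
have -> : e^-1 = (e^-1 `^ s^-1) `^ s.
  by rewrite -powRrM mulVf ?gt_eqF// powRr1// invr_ge0 ltW.
by apply: ge0_ler_powR; rewrite ?nnegrE ?powR_ge0// ltW.
Unshelve. all: end_near. Qed.

(** The factor [t `^ (1 - 1)] is kept so that the integrand is literally that of
    [egammaM] at [p = 1], where the Beta integral is elementary. *)
Lemma integral_powR_shift s : 0 < s ->
  (\int[mu]_(t in D) (t `^ (1 - 1) * (t + 1) `^ (- (1 + s)))%R%:E = s^-1%:E)%E.
Proof.
move=> s0.
have t1 t : 0 <= t -> 0 < t + 1 by move=> t0; rewrite ltr_wpDl.
have df r t : 0 <= t ->
    is_derive t 1 (fun t => (t + 1) `^ r) (r * (t + 1) `^ (r - 1)).
  move=> t0.
  have h1 : is_derive (t + 1) 1 (fun x => x `^ r) (r * (t + 1) `^ (r - 1)).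
    exact: is_derive1_powR (t1 _ t0).
  have h2 : is_derive t 1 (fun t => t + 1) (1 + 0) by exact: is_deriveD.
  have := @is_derive1_comp R (fun x => x `^ r) (fun t => t + 1) t _ _ h1 h2.
  by rewrite addr0 mulr1.
pose F t : R := - s^-1 * (t + 1) `^ (- s).
rewrite (@integral_itv_obnd_cbnd R 0 +oo%O); last first.
  by apply: measurable_EFin_on; exact: measurable_powR_shift.
under eq_integral do rewrite subrr powRr0 mul1r.
rewrite (@ge0_continuous_FTC2y _ _ F 0 0).
- by rewrite /F/= !add0r powR1 mulr1 opprK.
- by move=> t _; rewrite powR_ge0.
- apply: derivable_within_continuous => t; rewrite in_itv/= andbT => t0.
  by have [] := df (- (1 + s)) t t0.
- rewrite /F -(mulr0 (- s^-1)); apply: cvgMl_tmp; exact: cvg_powR_shift.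
- move=> t t0; rewrite /F; apply: derivableM => //.
  by have [] := df (- s) t (ltW t0).
- apply: cvg_at_right_filter; rewrite /F; apply: cvgMl_tmp.
  have [d _] := df (- s) 0 (lexx 0).
  by move: d => /derivable1_diffP/differentiable_continuous.
- move=> t; rewrite in_itv/= andbT => t0; rewrite derive1E /F.
  have [d e] := df (- s) t (ltW t0).
  rewrite deriveMl// e.
  rewrite mulrA mulrNN mulVf ?gt_eqF// mul1r; congr (_ `^ _); ring.
Qed.

Lemma egamma1 : egamma (1 : R) = 1%E.
Proof.
rewrite /egamma (@integral_itv_obnd_cbnd R 0 +oo%O); last first.
  by apply: measurable_EFin_on; exact: measurable_gamma_density.
under eq_integral do rewrite subrr powRr0 mul1r.
rewrite (@ge0_continuous_FTC2y _ _ (fun x => - expR (- x)) 0 0).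
- by rewrite oppr0 expR0 sub0e EFinN oppeK.
- by move=> t _; rewrite expR_ge0.
- by apply: derivable_within_continuous => t _; apply: ex_derive.
- by rewrite -oppr0; apply: cvgN; exact: cvgr_expR.
- by move=> t _; apply: ex_derive.
- apply: cvg_at_right_filter; apply: cvgN.
  by apply: continuous_comp; [exact: continuousN|exact: continuous_expR].
- by move=> t _; rewrite derive1E derive_val; rewrite /GRing.scale/=; ring.
Qed.

(** No integration by parts: this is [egammaM] at [p = 1]. *)
Lemma egammaS s : 0 < s -> egamma s = (s^-1%:E * egamma (s + 1))%E.
Proof.
move=> s0; have := egammaM 1 s.
by rewrite egamma1 mul1e integral_powR_shift// muleC [1 + s]addrC.
Qed.

Lemma egamma_nat n : (egamma (n.+1%:R : R) < +oo)%E.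
Proof.
elim: n => [|n IHn]; first by rewrite egamma1 ltry.
have n0 : 0 < n.+1%:R :> R by rewrite ltr0n.
move: IHn; rewrite egammaS// natr1.
by case: (egamma _) => [r||]; rewrite ?ltry// mulry gtr0_sg ?invr_gt0// mul1e.
Qed.

(** For [1 <= s' < n.+1], [x `^ (s' - 1) <= 1 + x `^ n] bounds the integrand by
    two integrands with positive integer parameter; [egammaS] lowers the
    parameter to [0 < s < 1]. *)
Lemma egamma_lty s : 0 < s -> (egamma s < +oo)%E.
Proof.
have big s' : 1 <= s' -> (egamma s' < +oo)%E.
  move=> s1; have [n s'n] : exists n, s' < n.+1%:R.
    by exists (Num.truncn s'); exact: truncnS_gt.
  have mx s2 : measurable_fun D (fun x => (x `^ (s2 - 1) * expR (- x))%:E).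
    by apply: measurable_EFin_on; exact: measurable_gamma_density.
  have f0 s2 x : D x -> (0 <= (x `^ (s2 - 1) * expR (- x))%:E)%E.
    by move=> _; rewrite lee_fin gamma_density_ge0.
  apply: (@le_lt_trans _ _ (egamma (1 : R) + egamma (n.+1%:R : R))%E);
      last first.
    apply: lte_add_pinfty; last exact: egamma_nat.
    by rewrite egamma1 ltry.
  rewrite /egamma -ge0_integralD//; [|exact: f0|exact: mx|exact: f0|exact: mx].
  apply: ge0_le_integral => //; first exact: f0.
  - exact: mx.
  - by apply: emeasurable_funD; exact: mx.
  move=> x; rewrite /= in_itv/= andbT => x0.
  rewrite -EFinD lee_fin -mulrDl ler_wpM2r ?expR_ge0// subrr powRr0.
  have [x1|/ltW x1] := leP x 1.
    rewrite -[leLHS]addr0 lerD ?powR_ge0//.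
    by rewrite -[leRHS](powRr0 x) ger_powR ?x0// subr_ge0.
  by rewrite -[leLHS]add0r lerD// ler_powR// lerD2r ltW.
move=> s0; have [s1|s1] := leP 1 s; first exact: big.
have : (egamma (s + 1) < +oo)%E by apply: big; rewrite lerDr ltW.
rewrite (egammaS s0); have := egamma_ge0 (s + 1).
by case: (egamma _) => [r _ _||]//; rewrite -EFinM ltry.
Qed.

Lemma egammaE s : 0 < s -> egamma s = (Gamma s)%:E.
Proof.
move=> s0; rewrite /Gamma /integral_pos /Rintegral fineK//.
by rewrite ge0_fin_numE ?egamma_ge0//; exact: egamma_lty.
Qed.

Lemma GammaS s : 0 < s -> Gamma (s + 1) = s * Gamma s.
Proof.
move=> s0; have := egammaS s0; rewrite !egammaE ?addr_gt0// -EFinM => -[->].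
by rewrite mulrA mulfV ?mul1r// gt_eqF.
Qed.

(** For [1 <= s'] the integrand is at least [expR (- 2)] on [`[1, 2]]. *)
Lemma Gamma_gt0 s : 0 < s -> 0 < Gamma s.
Proof.
have big s' : 1 <= s' -> 0 < Gamma s'.
  move=> s1; rewrite -lte_fin -egammaE; last exact: lt_le_trans s1.
  apply: (@lt_le_trans _ _
      (\int[mu]_(x in `[1%R, 2%R]) (cst (expR (- 2))%:E x))%E).
    rewrite integral_cst//= lebesgue_measure_itv/= lte_fin ltr1n/=.
    rewrite -EFinB -EFinM lte_fin.
    by rewrite mulr_gt0 ?expR_gt0//; lra.
  apply: (@le_trans _ _
      (\int[mu]_(x in `[1%R, 2%R]) (x `^ (s' - 1) * expR (- x))%R%:E)%E).
    apply: ge0_le_integral => //.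
    - by move=> x _; rewrite lee_fin expR_ge0.
    - by apply: measurable_EFin_on; exact: measurable_gamma_density.
    move=> x; rewrite /= in_itv/= => /andP[x1 x2].
    rewrite lee_fin -[leLHS]mul1r ler_pM ?expR_ge0// ?ler_expR ?lerN2//.
    by rewrite -[leLHS](powRr0 x) ler_powR// subr_ge0.
  apply: ge0_subset_integral => //.
  - by apply: measurable_EFin_on; exact: measurable_gamma_density.
  - by move=> x _; rewrite lee_fin gamma_density_ge0.
  - move=> x /=; rewrite !in_itv/= andbT => /andP[x1 _].
    exact: lt_le_trans x1.
move=> s0; have := big (s + 1); rewrite lerDr ltW// => /(_ isT).
by rewrite GammaS// pmulr_rgt0.
Qed.

End half_line.

(** * Pochhammer symbols *)

Section pochhammer.
Context {R : realType}.
Implicit Types (s z : R).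

Lemma pochhammerS s k : pochhammer s k.+1 = pochhammer s k * (s + k%:R).
Proof. by rewrite /pochhammer big_ord_recr. Qed.

Lemma pochhammer_gt0 s k : 0 < s -> 0 < pochhammer s k.
Proof. by move=> s0; apply: prodr_gt0 => i _; rewrite ltr_wpDr. Qed.

Lemma pochhammerD z m n :
  pochhammer z (m + n) = pochhammer z m * pochhammer (z + m%:R) n.
Proof.
rewrite /pochhammer big_split_ord/=; congr (_ * _).
by apply: eq_bigr => i _; rewrite natrD addrA.
Qed.

(** For [n < j] both sides vanish, which is what makes the hypergeometric series
    terminate. *)
Lemma pochhammerN (n j : nat) :
  pochhammer (- n%:R : R) j = (-1) ^+ j * (n ^_ j)%:R.
Proof.
elim: j => [|j IHj]; first by rewrite /pochhammer big_ord0 ffactn0 mulr1.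
rewrite pochhammerS IHj ffactnSr natrM exprS.
have [jn|nj] := leqP j n; first by rewrite natrB//; ring.
by rewrite ffact_small// !mul0r !mulr0 mul0r.
Qed.

Lemma Gamma_pochhammer s k : 0 < s ->
  Gamma (s + k%:R) = pochhammer s k * Gamma s.
Proof.
move=> s0; elim: k => [|k IHk].
  by rewrite addr0 /pochhammer big_ord0 mul1r.
have sk0 : 0 < s + k%:R by rewrite ltr_wpDr.
by rewrite -natr1 addrA (GammaS sk0) IHk pochhammerS; ring.
Qed.

End pochhammer.

(** * Moments of the weight *)

Section weight_moments.
Context {R : realType}.
Local Open Scope classical_set_scope.
Local Open Scope ring_scope.
Local Notation mu := (@lebesgue_measure R).
Local Notation D := (`]0, +oo[%classic : set R).
Implicit Types (a b c be x t : R).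

Definition tricomi_integral c be x : \bar R :=
  (\int[mu]_(t in D) (t `^ (c - 1) * (t + 1) `^ be * expR (- (t * x)))%R%:E)%E.

Lemma tricomi_integral_ge0 c be x : (0 <= tricomi_integral c be x)%E.
Proof.
by apply: integral_ge0 => t _; rewrite lee_fin !mulr_ge0 ?powR_ge0 ?expR_ge0.
Qed.

Lemma measurable_tricomi_integral c be :
  measurable_fun setT (tricomi_integral c be).
Proof.
pose f (z : R * R) : \bar R := (z.2 `^ (c - 1) * (z.2 + 1) `^ be *
  expR (- (z.2 * z.1)) * \1_D z.2)%:E.
have mf : measurable_fun setT f.
  apply/measurable_EFinP; apply: measurable_funM; last exact: measurableT_comp.
  apply: measurable_funM.
    exact: (measurableT_comp (measurable_powR_shift (c - 1) be)).
  apply: measurableT_comp => //; apply: measurableT_comp => //.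
  exact: measurable_funM.
have f0 z : (0 <= f z)%E.
  by rewrite lee_fin !mulr_ge0 ?powR_ge0 ?expR_ge0.
have mF := @measurable_fun_fubini_tonelli_F _ _ (measurableTypeR R)
  (measurableTypeR R) R mu f mf f0.
suff -> : tricomi_integral c be = fubini_F mu f by exact: mF.
apply/funext => x; rewrite /fubini_F /tricomi_integral [LHS]integral_mkcond.
apply: eq_integral => t _; rewrite patchE /f/= indicE.
by case: ifPn => _; rewrite ?mulr1 ?mulr0.
Qed.

(** [weightW] contains the [fine] of this integral; finiteness at every [x > 0]
    identifies the two.  The exponent [be] is [a - b - c] there, so [a - b < c]
    makes the factor [(t + 1) `^ be] at most [1]. *)
Lemma tricomi_integral_lty c be x : 0 < c -> be <= 0 -> 0 < x ->
  (tricomi_integral c be x < +oo)%E.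
Proof.
move=> c0 be0 x0.
apply: (@le_lt_trans _ _
  (\int[mu]_(t in D) (t `^ (c - 1) * expR (- (x * t)))%R%:E)%E); last first.
  by rewrite laplace_powR// egammaE// -EFinM ltry.
apply: ge0_le_integral => //.
- by move=> t _; rewrite lee_fin !mulr_ge0 ?powR_ge0 ?expR_ge0.
- apply: measurable_EFin_on.
  apply: measurable_funM; first exact: measurable_powR_shift.
  exact: measurable_expRM.
- by apply: measurable_EFin_on; exact: measurable_gamma_integrand.
move=> t; rewrite /= in_itv/= andbT => t0; rewrite lee_fin [x * t]mulrC.
rewrite ler_wpM2r ?expR_ge0// ler_piMr ?powR_ge0//.
by rewrite -[leRHS](powRr0 (t + 1)) ler_powR// lerDr ltW.
Qed.

Definition moment a b c k : R :=
  pochhammer (a + 1) k * pochhammer (b + 1) k / pochhammer (c + b + 1) k.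

Definition weightW_const a b c : R :=
  Gamma (c + b + 1) / (Gamma (a + 1) * Gamma (b + 1)) / Gamma c.

Lemma weightW_const_ge0 a b c : 0 < a + 1 -> 0 < b + 1 -> 0 < c ->
  0 < c + b + 1 -> 0 <= weightW_const a b c.
Proof.
by move=> a0 b0 c0 cb0; rewrite !divr_ge0 ?mulr_ge0 ?ltW ?Gamma_gt0.
Qed.

(** The right-hand side matches the left-hand side of [integral_laplace_powR] at
    [s = a + 1 + k%:R]. *)
Lemma weightW_moment_expand a b c k x : 0 < c -> a - b < c -> 0 < x ->
  (x ^+ k * weightW a b c x)%:E =
  ((weightW_const a b c)%:E * ((x `^ (a + 1 + k%:R - 1) * expR (- x))%:E *
    tricomi_integral c (a - b - c) x))%E.
Proof.
move=> c0 abc x0.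
rewrite /weightW_const /weightW /tricomiU /integral_pos /Rintegral.
rewrite (_ : a - b + 1 - c - 1 = a - b - c); last by ring.
rewrite -/(tricomi_integral c (a - b - c) x).
have : tricomi_integral c (a - b - c) x \is a fin_num.
  rewrite ge0_fin_numE ?tricomi_integral_ge0// tricomi_integral_lty//.
  by rewrite subr_le0 ltW.
case: (tricomi_integral _ _ _) => [r _||]//=; rewrite -!EFinM; congr EFin.
rewrite (_ : a + 1 + k%:R - 1 = a + k%:R); last by ring.
rewrite powRD ?(gt_eqF x0) ?implybT// powR_mulrn ?ltW//; ring.
Qed.

(** The two integrals are [Gamma (a + 1 + k)] and the Beta integral of [c] and
    [b + 1 + k]; the normalization of the weight leaves Pochhammer symbols. *)
Lemma integral_weightW_moment a b c k :
  -1 < a -> -1 < b -> 0 < c -> a - b < c ->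
  (\int[mu]_(x in D) (x ^+ k * weightW a b c x)%R%:E = (moment a b c k)%:E)%E.
Proof.
move=> a1 b1 c0 abc.
have a0 : 0 < a + 1 by rewrite -ltrBlDr sub0r.
have b0 : 0 < b + 1 by rewrite -ltrBlDr sub0r.
have cb0 : 0 < c + b + 1 by rewrite -addrA addr_gt0.
transitivity (\int[mu]_(x in D)
  ((weightW_const a b c)%:E * ((x `^ (a + 1 + k%:R - 1) * expR (- x))%R%:E *
    tricomi_integral c (a - b - c) x)))%E.
  apply: eq_integral => x; rewrite inE/= in_itv/= andbT => x0.
  exact: weightW_moment_expand.
rewrite ge0_integralZl; first last.
- by rewrite lee_fin weightW_const_ge0.
- move=> x _; rewrite mule_ge0 ?tricomi_integral_ge0//.
  by rewrite lee_fin gamma_density_ge0.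
- apply: measurable_funTS; apply: emeasurable_funM.
    by apply: measurable_EFin_on; exact: measurable_gamma_density.
  exact: measurable_tricomi_integral.
- exact: measurable_itv.
rewrite integral_laplace_powR.
(* The exponent is now that of the Beta integral in [egammaM]. *)
rewrite (_ : a - b - c - (a + 1 + k%:R) = - (c + (b + 1 + k%:R))); last by ring.
have bk0 : 0 < b + 1 + k%:R by rewrite ltr_wpDr.
have gab := Gamma_gt0 a0; have gb := Gamma_gt0 b0; have gc := Gamma_gt0 c0.
have gcb := Gamma_gt0 cb0; have pcb := pochhammer_gt0 k cb0.
have ak0 : 0 < a + 1 + k%:R by rewrite ltr_wpDr.
have cbk0 : 0 < c + b + 1 + k%:R by rewrite ltr_wpDr.
have := egammaM c (b + 1 + k%:R); rewrite (egammaE c0) (egammaE bk0).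
rewrite (_ : c + (b + 1 + k%:R) = c + b + 1 + k%:R); last by ring.
rewrite (egammaE cbk0) (egammaE ak0).
rewrite (Gamma_pochhammer _ a0) (Gamma_pochhammer _ b0).
rewrite (Gamma_pochhammer _ cb0).
have J0 : (0 <= \int[mu]_(t in D)
    (t `^ (c - 1) * (t + 1) `^ (- (c + b + 1 + k%:R)))%R%:E)%E.
  by apply: integral_ge0 => t _; rewrite lee_fin mulr_ge0 ?powR_ge0.
rewrite /moment /weightW_const; move: (integral _ _ _) J0 => J J0.
(* The Gamma values become variables: only their being nonzero is needed below,
   and unification is kept from unfolding them. *)
move: (Gamma (a + 1)) (Gamma (b + 1)) (Gamma c) (Gamma (c + b + 1))
  (pochhammer (c + b + 1) k) (lt0r_neq0 gab) (lt0r_neq0 gb) (lt0r_neq0 gc)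
  (lt0r_neq0 gcb) (lt0r_neq0 pcb) (gtr0_sg (mulr_gt0 pcb gcb)).
move=> ga gb' gc' gcb' p ga0 gb0 gc0 gcb0 p0 sg1.
case: J J0 => [r _||//]; last by rewrite mulry sg1 mul1e.
rewrite -!EFinM => -[e]; congr EFin.
rewrite (_ : r = gc' * (pochhammer (b + 1) k * gb') / (p * gcb')); last first.
  by rewrite e mulrAC mulfV ?mul1r// mulf_neq0.
by field; rewrite ga0 gb0 gc0 gcb0 p0.
Qed.

Lemma integrable_weightW_moment a b c k :
  -1 < a -> -1 < b -> 0 < c -> a - b < c ->
  mu.-integrable D (fun x => (x ^+ k * weightW a b c x)%:E).
Proof.
move=> a1 b1 c0 abc.
have a0 : 0 < a + 1 by rewrite -ltrBlDr sub0r.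
have b0 : 0 < b + 1 by rewrite -ltrBlDr sub0r.
have cb0 : 0 < c + b + 1 by rewrite -addrA addr_gt0.
apply/integrableP; split.
  apply: (@eq_measurable_fun _ _ _ _ _ (fun x => (weightW_const a b c)%:E *
    ((x `^ (a + 1 + k%:R - 1) * expR (- x))%R%:E *
      tricomi_integral c (a - b - c) x))%E).
    move=> x; rewrite inE/= in_itv/= andbT => x0; apply/esym.
    exact: weightW_moment_expand.
  apply: measurable_funTS; apply: measurable_funeM; apply: emeasurable_funM.
    by apply: measurable_EFin_on; exact: measurable_gamma_density.
  exact: measurable_tricomi_integral.
rewrite (_ : (\int[mu]_(x in D) _)%E =
    (\int[mu]_(x in D) (x ^+ k * weightW a b c x)%R%:E)%E).
  by rewrite integral_weightW_moment// ltry.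
apply: eq_integral => x; rewrite inE/= in_itv/= andbT => x0.
rewrite /= ger0_norm// -lee_fin weightW_moment_expand// mule_ge0//.
  by rewrite lee_fin weightW_const_ge0.
by rewrite mule_ge0 ?tricomi_integral_ge0// lee_fin gamma_density_ge0.
Qed.

Lemma integral_pos_poly (w : R -> R) (m : nat -> R) :
  (forall k, mu.-integrable D (fun x => (x ^+ k * w x)%:E)) ->
  (forall k, integral_pos (fun x => x ^+ k * w x) = m k) ->
  forall p : {poly R},
  integral_pos (fun x => p.[x] * w x) = \sum_(i < size p) p`_i * m i.
Proof.
move=> iw mw p; under eq_fun do rewrite horner_coef.
have mD : measurable (D : set (measurableTypeR R)) by exact: measurable_itv.
suff [] : mu.-integrable D
     (EFin \o (fun x => (\sum_(i < size p) p`_i * x ^+ i) * w x)) /\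
   integral_pos (fun x => (\sum_(i < size p) p`_i * x ^+ i) * w x) =
   \sum_(i < size p) p`_i * m i by [].
elim: (size p) => [|n [IHi IHe]].
  rewrite (_ : (fun x => (\sum_(i < 0) p`_i * x ^+ i) * w x) = cst 0).
    rewrite big_ord0 /integral_pos /Rintegral integral0; split=> //.
    exact: integrable0.
  by apply/funext => x; rewrite big_ord0 mul0r.
rewrite (_ : (fun x => (\sum_(i < n.+1) p`_i * x ^+ i) * w x) = fun x =>
    (\sum_(i < n) p`_i * x ^+ i) * w x + p`_n * (x ^+ n * w x)); last first.
  by apply/funext => x; rewrite big_ord_recr/= mulrDl mulrA.
have In : mu.-integrable D (fun x => (p`_n * (x ^+ n * w x))%:E).
  by have := integrableZl mD p`_n (iw n); apply: eq_integrable.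
split; first exact: (integrableD mD IHi In).
rewrite /integral_pos RintegralD// RintegralZl//; last exact: iw.
by rewrite big_ord_recr/= -IHe -mw.
Qed.

End weight_moments.

(** * The proposed polynomial is orthogonal *)

Section finite_differences.
Context {R : realType}.
Implicit Types (p q : {poly R}) (z : R).

(** The forward difference lowers the degree because [p] and its shift have the
    same leading coefficient. *)
Lemma size_shift_sub p : (size (p \Po ('X + 1) - p)%R <= (size p).-1)%N.
Proof.
have sX : size ('X + 1 : {poly R}) = 2 by rewrite -(size_XaddC (1 : R)).
have lX : lead_coef ('X + 1 : {poly R}) = 1.
  by rewrite -(lead_coefXaddC (1 : R)).
have sc : size (p \Po ('X + 1)) = size p by rewrite size_comp_poly2.
have [->|p0] := eqVneq p 0; first by rewrite comp_poly0 subr0 size_poly0.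
apply/leq_sizeP => i; rewrite leq_eqVlt => /predU1P[<-|].
  rewrite coefB -{1}sc -/(lead_coef _) -/(lead_coef _).
  by rewrite lead_coef_comp ?sX// lX expr1n mulr1 subrr.
move=> pi; have {}pi : (size p <= i)%N by move: pi; case: (size p).
by rewrite coefB !nth_default ?subr0 ?sc.
Qed.

(** The sum is the [n]-th forward difference of [p] at [0]; by Pascal's rule one
    difference can be moved onto [p]. *)
Lemma alternating_binomial_sum n p : (size p <= n)%N ->
  \sum_(j < n.+1) (-1) ^+ (n - j) * ('C(n, j))%:R * p.[j%:R] = 0.
Proof.
elim: n p => [|n IHn] p.
  rewrite leqn0 size_poly_eq0 => /eqP ->.
  by rewrite big_ord1 horner0 mulr0.
move=> pn; rewrite -[RHS](IHn (p \Po ('X + 1) - p)); last first.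
  by have := size_shift_sub p; lia.
under [RHS]eq_bigr => j _.
  rewrite hornerD hornerN horner_comp !hornerE mulrBr; over.
pose T := \sum_(j < n.+1) (-1) ^+ (n - j) * ('C(n, j.+1))%:R * p.[j.+1%:R].
have pascal : \sum_(j < n.+2) (-1) ^+ (n.+1 - j) * ('C(n.+1, j))%:R * p.[j%:R] =
    (-1) ^+ n.+1 * p.[0] + T +
    \sum_(j < n.+1) (-1) ^+ (n - j) * ('C(n, j))%:R * p.[j.+1%:R].
  rewrite big_ord_recl/= subn0 bin0 mulr1 -addrA -big_split/=; congr (_ + _).
  apply: eq_bigr => j _.
  by rewrite /bump/= add1n subSS binS natrD mulrDr mulrDl.
have shift : \sum_(j < n.+1) (-1) ^+ (n - j) * ('C(n, j))%:R * p.[j%:R] =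
    (-1) ^+ n * p.[0] - T.
  rewrite big_ord_recl/= subn0 bin0 mulr1 /T big_ord_recr/= bin_small//.
  rewrite mulr0 mul0r addr0 -sumrN; congr (_ + _).
  apply: eq_bigr => j _; rewrite /bump/= add1n.
  rewrite (_ : (n - j = (n - j.+1).+1)%N); last by have := ltn_ord j; lia.
  by rewrite exprS !mulN1r !mulNr opprK.
rewrite pascal sumrB shift exprS mulN1r mulNr.
rewrite opprB addrC [_ + T]addrC; congr (_ + _).
by apply: eq_bigr => j _; rewrite natr1.
Qed.

Definition pochhammerX z k : {poly R} := \prod_(i < k) ('X + (z + i%:R)%:P).

Lemma size_pochhammerX z k : size (pochhammerX z k) = k.+1.
Proof.
rewrite /pochhammerX size_prod; last first.
  by move=> i _; rewrite -size_poly_eq0 size_XaddC.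
under eq_bigr do rewrite size_XaddC.
rewrite sum_nat_const card_ord; lia.
Qed.

Lemma horner_pochhammerX z k x :
  (pochhammerX z k).[x] = pochhammer (z + x) k.
Proof.
rewrite /pochhammerX horner_prod; apply: eq_bigr => i _.
by rewrite hornerD hornerX hornerC addrCA addrA.
Qed.

(** [k + d' <= M] is what turns [(e + M)_j / (e + d')_(k + j)] into a polynomial
    in [j], up to a constant factor. *)
Lemma tau_moment (a b c : R) (d d' k n j : nat) :
  let e := c + b + 1 in let M := (n + d)./2 in
  0 < a + 1 -> 0 < b + 1 -> 0 < e ->
  (k + d' <= M)%N -> (j <= n)%N ->
  tau d a b c n j * moment a b (c + d'%:R) (k + j) =
  pochhammer (a + 1) n * pochhammer (b + 1) n /
    (pochhammer (e + M%:R) n * pochhammer (e + d'%:R) (M - d')) *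
  ((-1) ^+ (n - j) * ('C(n, j))%:R *
   (pochhammer (a + 1 + j%:R) k * pochhammer (b + 1 + j%:R) k *
    pochhammer (e + d'%:R + k%:R + j%:R) (M - d' - k))).
Proof.
move=> e M a0 b0 e0 kM jn; rewrite /tau /moment -/e -/M.
rewrite (_ : c + d'%:R + b + 1 = e + d'%:R); last by rewrite /e; ring.
have ed0 : 0 < e + d'%:R by rewrite ltr_wpDr.
have eM0 : 0 < e + M%:R by rewrite ltr_wpDr.
have split_n z :
    pochhammer z n = pochhammer z j * pochhammer (z + j%:R) (n - j).
  by rewrite -pochhammerD subnKC.
have ejM : pochhammer (e + d'%:R) (k + j) *
    pochhammer (e + d'%:R + k%:R + j%:R) (M - d' - k)
    = pochhammer (e + d'%:R) (M - d') * pochhammer (e + M%:R) j.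
  (* Both sides are [(e + d')_(M - d' + j)]. *)
  rewrite -(addrA (e + d'%:R)) -natrD -pochhammerD.
  rewrite (_ : (k + j + (M - d' - k) = (M - d') + j)%N); last by lia.
  by rewrite pochhammerD -(addrA e) -natrD subnKC//; lia.
rewrite ![(k + j)%N]addnC in ejM *.
rewrite !split_n [pochhammer (a + 1) (j + k)]pochhammerD.
rewrite [pochhammer (b + 1) (j + k)]pochhammerD.
have h1 := lt0r_neq0 (pochhammer_gt0 (j + k) ed0).
have h2 := lt0r_neq0 (pochhammer_gt0 (M - d') ed0).
have h3 := lt0r_neq0 (pochhammer_gt0 j eM0).
have h4 : pochhammer (e + M%:R + j%:R) (n - j) != 0.
  by apply: lt0r_neq0; rewrite pochhammer_gt0// ltr_wpDr.
have -> : pochhammer (e + d'%:R + k%:R + j%:R) (M - d' - k) =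
    pochhammer (e + d'%:R) (M - d') * pochhammer (e + M%:R) j /
    pochhammer (e + d'%:R) (j + k).
  by rewrite -ejM mulrAC mulfV ?mul1r.
by field; rewrite h1 h2 h3 h4.
Qed.

(** By [tau_moment] the sum is an [n]-th finite difference of a polynomial of
    degree [2k + (M - d' - k)]; [M + k < n + d'] makes this less than [n]. *)
Lemma sum_tau_moment_eq0 (a b c : R) (d d' k n : nat) :
  let M := (n + d)./2 in
  0 < a + 1 -> 0 < b + 1 -> 0 < c + b + 1 ->
  (k + d' <= M)%N -> (M + k < n + d')%N ->
  \sum_(j < n.+1) tau d a b c n j * moment a b (c + d'%:R) (k + j) = 0.
Proof.
move=> M a0 b0 e0 kM Mk.
under eq_bigr => j _
  do rewrite (tau_moment a0 b0 e0 kM (ltn_ord j : (j <= n)%N)).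
rewrite -mulr_sumr; apply/eqP; rewrite mulf_eq0; apply/orP; right; apply/eqP.
pose p := pochhammerX (a + 1) k * pochhammerX (b + 1) k *
  pochhammerX (c + b + 1 + d'%:R + k%:R) (M - d' - k).
rewrite -[RHS](@alternating_binomial_sum n p); last first.
  apply: (leq_trans (size_polyMleq _ _)).
  have := size_polyMleq (pochhammerX (a + 1) k) (pochhammerX (b + 1) k).
  rewrite !size_pochhammerX; lia.
by apply: eq_bigr => j _; rewrite !hornerM !horner_pochhammerX.
Qed.

(** In the [j]-th orthogonality condition the power is [k = j./2] and the
    weight parameter is [c + d'], with [d' = d] for the first weight ([j] even)
    and [d' = 1 - d] for the second one ([j] odd). *)
Lemma orthogonality_index_bounds (d n j : nat) :
  (d <= 1)%N -> (j < n)%N ->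
  let d' := if odd j then (1 - d)%N else d in
  (j./2 + d' <= (n + d)./2)%N /\ ((n + d)./2 + j./2 < n + d')%N.
Proof.
by move=> d1 jn; have := odd_double_half j; case: (odd j) => /= ?; split; lia.
Qed.

End finite_differences.

(** * Uniqueness *)

(** The value on [q] of integration against a weight with moments [m], after
    multiplication by the [k]-th power of the variable. *)
Definition moment_functional (R : realType) (m : nat -> R) (k : nat)
    (q : {poly R}) : R := \sum_(i < size q) q`_i * m (k + i)%N.

Section moment_functional.
Context {R : realType}.
Variables (m : nat -> R) (k : nat).

Lemma moment_functional_widen N (q : {poly R}) : (size q <= N)%N ->
  moment_functional m k q = \sum_(i < N) q`_i * m (k + i)%N.
Proof.
move=> qN; rewrite /moment_functional.
rewrite (big_ord_widen N (fun i => q`_i * m (k + i)%N) qN) big_mkcond/=.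
apply: eq_bigr => i _; case: ltnP => // qi.
by rewrite nth_default// mul0r.
Qed.

Lemma moment_functional_is_scalar : scalar (moment_functional m k).
Proof.
move=> x p q; pose N := maxn (size p) (size q).
have pN : (size p <= N)%N by exact: leq_maxl.
have qN : (size q <= N)%N by exact: leq_maxr.
rewrite (moment_functional_widen pN) (moment_functional_widen qN).
rewrite (@moment_functional_widen N); last first.
  rewrite (leq_trans (size_polyD _ _))// geq_max qN andbT.
  by rewrite (leq_trans (size_scale_leq _ _)).
rewrite mulr_sumr -big_split/=; apply: eq_bigr => i _.
by rewrite coefD coefZ mulrDl mulrA.
Qed.

HB.instance Definition _ := GRing.isLinear.Build R {poly R} R *%R
  (moment_functional m k) moment_functional_is_scalar.

End moment_functional.

Lemma moment_functionalXn (R : realType) (m : nat -> R) k (q : {poly R}) :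
  moment_functional m 0 ('X^k * q) = moment_functional m k q.
Proof.
have [->|q0] := eqVneq q 0.
  by rewrite mulr0 /moment_functional size_poly0 !big_ord0.
rewrite {1}/moment_functional mulrC size_mulXn//.
rewrite big_split_ord/= big1 ?add0r; last first.
  by move=> i _; rewrite coefMXn ltn_ord mul0r.
apply: eq_bigr => i _; rewrite coefMXn ltnNge leq_addr/= addKn//.
Qed.

Lemma monic_basis (R : realType) (P : nat -> {poly R}) (n : nat)
    (q : {poly R}) :
  (forall i, P i \is monic) -> (forall i, size (P i) = i.+1) ->
  (size q <= n)%N -> exists c : nat -> R, q = \sum_(i < n) c i *: P i.
Proof.
move=> monP sP; elim: n q => [|n IHn] q qn.
  exists (fun=> 0); rewrite big_ord0; apply/eqP.
  by rewrite -size_poly_eq0 -leqn0.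
have lP : (P n)`_n = 1.
  by have /monicP := monP n; rewrite /lead_coef sP.
have [|c qc] := IHn (q - q`_n *: P n).
  apply/leq_sizeP => i; rewrite leq_eqVlt => /predU1P[<-|ni].
    by rewrite coefB coefZ lP mulr1 subrr.
  rewrite coefB coefZ (nth_default 0 (leq_trans qn ni)) sub0r.
  by rewrite [(P n)`_i]nth_default ?sP// mulr0 oppr0.
exists (fun i => if i == n then q`_n else c i).
rewrite big_ord_recr/= eqxx -[LHS](subrK (q`_n *: P n)) qc; congr (_ + _).
by apply: eq_bigr => i _; rewrite ltn_eqF.
Qed.

(** Expand [q] in the [P i]: if the coefficients below [j] vanish, then
    [l j q] is the [j]-th coefficient times [l j (P j)]. *)
Lemma biorthogonal_eq0 (R : realType) (P : nat -> {poly R})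
    (l : nat -> {scalar {poly R}}) (n : nat) (q : {poly R}) :
  (forall i, P i \is monic) -> (forall i, size (P i) = i.+1) ->
  (forall i j, (j < i)%N -> l j (P i) = 0) ->
  (forall i, l i (P i) <> 0) ->
  (size q <= n)%N -> (forall j, (j < n)%N -> l j q = 0) -> q = 0.
Proof.
move=> monP sP l0 lN0 qn lq.
have [c qc] := monic_basis monP sP qn.
suff c0 j : (j < n)%N -> c j = 0.
  by rewrite qc big1// => i _; rewrite c0// scale0r.
elim/ltn_ind: j => j IHj jn.
have := lq j jn; rewrite qc linear_sum/= (bigD1 (Ordinal jn))//= big1 ?addr0.
  rewrite linearZ/= => /eqP; rewrite mulf_eq0 => /orP[/eqP//|/eqP].
  by move/lN0.
move=> i; rewrite -val_eqE/= neq_ltn => /orP[ij|ji]; rewrite linearZ/=.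
  by rewrite IHj// mul0r.
by rewrite l0// mulr0.
Qed.

(** * The hypergeometric form *)

Section tau.
Context {R : realType}.

Lemma tau_hyp2F2_coef (d : nat) (a b c : R) (n j : nat) :
  let e := c + b + 1 + ((n + d)./2)%:R in
  0 < a + 1 -> 0 < b + 1 -> 0 < e -> (j <= n)%N ->
  (-1) ^+ n * pochhammer (a + 1) n * pochhammer (b + 1) n / pochhammer e n *
  (pochhammer (- n%:R) j * pochhammer e j /
    (pochhammer (a + 1) j * pochhammer (b + 1) j) / (j`!)%:R) =
  tau d a b c n j.
Proof.
move=> e a0 b0 e0 jn; rewrite /tau -/e pochhammerN.
have split_n z :
    pochhammer z n = pochhammer z j * pochhammer (z + j%:R) (n - j).
  by rewrite -pochhammerD subnKC.
rewrite !split_n -bin_ffact natrM.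
have h1 := lt0r_neq0 (pochhammer_gt0 j a0).
have h2 := lt0r_neq0 (pochhammer_gt0 j b0).
have h3 := lt0r_neq0 (pochhammer_gt0 j e0).
have h4 : pochhammer (e + j%:R) (n - j) != 0.
  by apply: lt0r_neq0; rewrite pochhammer_gt0// ltr_wpDr.
have h5 : (j`!)%:R != 0 :> R by rewrite pnatr_eq0 -lt0n fact_gt0.
rewrite -{1}(subnK jn) exprD.
(* Name the sign: the identity needs only that its square is [1]. *)
have s2 : (-1) ^+ j * (-1) ^+ j = 1 :> R by rewrite -expr2 sqrr_sign.
move: s2; move: ((-1) ^+ j) => s s2.
transitivity ((-1) ^+ (n - j) * ('C(n, j))%:R * (s * s) *
  (pochhammer (a + 1 + j%:R) (n - j) * pochhammer (b + 1 + j%:R) (n - j)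
    / pochhammer (e + j%:R) (n - j))); last by rewrite s2 mulr1.
by field; rewrite h1 h2 h3 h4 h5.
Qed.

Lemma hyp2F2_terminating (n : nat) (e a b x : R) :
  hyp2F2 (- n%:R) e a b x =
  \sum_(j < n.+1) pochhammer (- n%:R) j * pochhammer e j /
    (pochhammer a j * pochhammer b j) * (x ^+ j / (j`!)%:R).
Proof.
rewrite /hyp2F2; apply: cvg_lim => //.
apply: cvg_near_cst; near=> N.
have nN : (n < N)%N by near: N; exact: nbhs_infty_gt.
rewrite /series/= big_mkord -(subnKC nN) big_split_ord/=.
rewrite [X in _ + X]big1 ?addr0//.
move=> i _; rewrite pochhammerN ffact_small ?mulr0 ?mul0r//; lia.
Unshelve. all: end_near. Qed.

Lemma tau_nn d (a b c : R) n : tau d a b c n n = 1.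
Proof.
by rewrite /tau subnn binn /pochhammer !big_ord0 !expr0 divr1 !mulr1.
Qed.

End tau.

Theorem theorem3p1 (R : realType) (a b c : R)
    (ha : -1 < a) (hb : -1 < b) (hc : Num.max 0 (a - b) < c)
    (d : nat) (hd : d \in [:: 0%N; 1%N])
    (P : nat -> {poly R})
    (P_monic : forall n : nat, P n \is monic)
    (P_orth : two_orthogonal P (weightWbar d a b c)) :
  forall n : nat,
    (forall x : R,
      (P n).[x] =
        (-1) ^+ n * pochhammer (a + 1) n * pochhammer (b + 1) n
          / pochhammer (c + b + 1 + ((n + d)./2)%:R) n
          * hyp2F2 (- n%:R) (c + b + 1 + ((n + d)./2)%:R) (a + 1) (b + 1) x) /\
    P n = \sum_(j < n.+1) tau d a b c n j *: 'X^j.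
Proof.
have [c0 abc] : 0 < c /\ a - b < c by move: hc; rewrite gt_max => /andP[].
have a0 : 0 < a + 1 by rewrite -ltrBlDr sub0r.
have b0 : 0 < b + 1 by rewrite -ltrBlDr sub0r.
have e0 : 0 < c + b + 1 by rewrite -addrA addr_gt0.
have d1 : (d <= 1)%N by move: hd; rewrite !inE => /orP[] /eqP->.
have {P_orth}[sP orthP] := P_orth.
(* The weights in a single sequence: the [j]-th orthogonality condition involves
   the weight with parameter [c + s j]. *)
pose s (j : nat) := if odd j then (1 - d)%N else d.
pose l j : {scalar {poly R}} :=
  moment_functional (moment a b (c + (s j)%:R)) j./2.
have integral_weight d' k q :
    integral_pos (fun x => x ^+ k * q.[x] * weightW a b (c + d'%:R) x) =
    moment_functional (moment a b (c + d'%:R)) k q.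
  have cd0 : 0 < c + d'%:R by rewrite ltr_wpDr.
  have abcd : a - b < c + d'%:R by rewrite ltr_wpDr.
  rewrite -moment_functionalXn.
  transitivity (integral_pos (fun x =>
      ('X^k * q).[x] * weightW a b (c + d'%:R) x)).
    by congr integral_pos; apply/funext => x; rewrite hornerM hornerXn.
  apply: integral_pos_poly => i; first exact: integrable_weightW_moment.
  by rewrite /integral_pos /Rintegral integral_weightW_moment.
have w2E : weightW a b (c + 1 - d%:R) = weightW a b (c + (1 - d)%:R).
  by rewrite (natrB _ d1) addrA.
have halfE j : j = (2 * j./2 + odd j)%N by rewrite addnC mul2n odd_double_half.
have l0 i j : (j < i)%N -> l j (P i) = 0.
  move=> ji; have [h1 _ h2 _] := orthP j./2 i.
  move: ji; rewrite {1}(halfE j) /l /s; case: (odd j) => /= ji.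
    by rewrite -integral_weight -w2E; apply: h2; rewrite addnS.
  by rewrite -integral_weight; apply: h1; rewrite addn1 -[X in (X < _)%N]addn0.
have lN0 i : l i (P i) <> 0.
  have [_ h1 _ h2] := orthP i./2 i.
  have := halfE i; rewrite /l /s; case: (odd i) => /= iE.
    by rewrite -integral_weight -w2E; exact: h2.
  by rewrite -integral_weight; apply: h1; rewrite {1}iE addn0.
move=> n.
pose Q := \sum_(j < n.+1) tau d a b c n j *: 'X^j.
have QE : Q = \poly_(j < n.+1) tau d a b c n j by rewrite poly_def.
have sPQ : (size (P n - Q)%R <= n)%N.
  apply/leq_sizeP => i; rewrite leq_eqVlt => /predU1P[<-|ni].
    rewrite coefB QE coef_poly ltnSn tau_nn.
    by have /monicP := P_monic n; rewrite /lead_coef sP/= => ->; rewrite subrr.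
  by rewrite coefB QE coef_poly ltnNge ni subr0 nth_default ?sP.
have lPQ j : (j < n)%N -> l j (P n - Q) = 0.
  move=> jn; have [jd nj] := orthogonality_index_bounds d1 jn.
  rewrite linearB/= (l0 _ _ jn) sub0r /l/=.
  rewrite (@moment_functional_widen _ _ _ n.+1); last by rewrite QE size_poly.
  rewrite (eq_bigr (fun i : 'I_n.+1 =>
    tau d a b c n i * moment a b (c + (s j)%:R) (j./2 + i))); last first.
    by move=> i _; rewrite QE coef_poly ltn_ord.
  by rewrite (sum_tau_moment_eq0 a0 b0 e0 jd nj) oppr0.
have PQ : P n = Q.
  by apply/eqP; rewrite -subr_eq0 (biorthogonal_eq0 P_monic sP l0 lN0 sPQ lPQ).
split; last exact: PQ.
move=> x.
have en0 : 0 < c + b + 1 + ((n + d)./2)%:R by rewrite ltr_wpDr.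
rewrite PQ /Q horner_sum hyp2F2_terminating mulr_sumr; apply: eq_bigr => j _.
rewrite hornerZ hornerXn -(tau_hyp2F2_coef a0 b0 en0 (ltn_ord j : (j <= n)%N)).
by ring.
Qed.
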